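(* Let $(\bar M,\bar g)$ be a Riemannian manifold and let $(\bar g,\bar J_1)$ and $(\bar g,\bar J_2)$ be two almost Hermitian structures on $\bar M$ that anti-commute, i.e. $\bar J_1\bar J_2=-\bar J_2\bar J_1$. Let $M$ be an immersed submanifold of $\bar M$ which, for $i=1,2$, is a pointwise slant submanifold of $(\bar M,\bar g,\bar J_i)$ with slant function $\theta_i$. Let $a,b$ be smooth functions on $\bar M$ with $a^2+b^2=1$, and let $\bar J_{a,b}:=a\bar J_1+b\bar J_2$ (so that $(\bar M,\bar g,\bar J_{a,b})$ is an almost Hermitian manifold). Then $M$ is a pointwise slant submanifold of the almost Hermitian manifold $(\bar M,\bar g,\bar J_{a,b})$ if and only if, for any $x\in M$ with $a(x)b(x)\neq 0$, the number $\bar g(T_1u,T_2u)$ does not depend on the unit tangent vector $u\in T_xM$. In this case, the slant function $\theta$ of $M$ in $(\bar M,\bar g,\bar J_{a,b})$ is given by $$\theta(x)=\arccos\Big(\sqrt{a^2(x)\cos^2\theta_1(x)+b^2(x)\cos^2\theta_2(x)+2a(x)b(x)\,\bar g(T_1u,T_2u)}\Big)$$ for any $x\in M$ and any $u\in T_xM$ with $\Vert u\Vert=1$.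
   Context: An almost complex structure on $\bar M$ is an endomorphism $\bar J$ of $T\bar M$ with $\bar J^2=-I$, where $I$ is the identity; if it is skew-symmetric with respect to $\bar g$, then $(\bar g,\bar J)$ is an almost Hermitian structure on $\bar M$ and $(\bar M,\bar g,\bar J)$ is an almost Hermitian manifold. All immersions are assumed injective, and the same symbol denotes a metric and the induced metric on a submanifold. For a submanifold $M$ of $\bar M$ and $X$ tangent to $M$, write $\bar J_iX=T_iX+N_iX$, where $T_iX$ and $N_iX$ are the components of $\bar J_iX$ tangent and normal to $M$, respectively. An immersed submanifold $M$ of an almost Hermitian manifold $(\bar M,\bar g,\bar J)$ is called a pointwise slant submanifold with slant function $\theta$, where $\theta(x)\in(0,\frac{\pi}{2}]$ for any $x\in M$, if, for every $x\in M$ and every nonzero $v\in T_xM$, the angle between $\bar Jv$ and $T_xM$ does not depend on $v$ but only on the point $x$; its value is $\theta(x)$. In this case, if $Tv$ denotes the component of $\bar Jv$ tangent to $M$, then $\Vert Tv\Vert^2=\cos^2\theta(x)\Vert v\Vert^2$ for all $v\in T_xM$.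
   Formalization: The ''if'' fails when θ must lie in (0,π/2], since M may be J_{a,b}-invariant (θ=0). Proved instead: the equivalence with θ=0 allowed for J_{a,b}, and the equivalence for θ in (0,π/2] with the added condition that no nonzero tangent v has J_{a,b}v tangent to M. *)

(* Defs.v *)
From HB Require Import structures.
From mathcomp Require Import all_boot all_order all_algebra.
From mathcomp Require Import all_classical all_reals all_analysis.

Set Implicit Arguments.
Unset Strict Implicit.
Unset Printing Implicit Defensive.

Import Order.TTheory GRing.Theory Num.Theory.
Import numFieldNormedType.Exports.
Local Open Scope classical_set_scope.
Local Open Scope ring_scope.

(* C^k functions on an open set U of R^n.  At rank k+1, differentiability with
   C^k partial derivatives; on U this agrees with the usual C^(k+1). *)
Fixpoint Ck (R : realType) (n k : nat) (U : set 'rV[R]_n) (F : 'rV[R]_n -> R)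
    : Prop :=
  match k with
  | 0%N => forall y, U y -> {for y, continuous F}
  | k'.+1 => (forall y, U y -> differentiable F y) /\
             (forall i : 'I_n, Ck k' U ('D_(delta_mx 0 i) F))
  end.

Definition smooth_on (R : realType) (n : nat) (U : set 'rV[R]_n)
  (F : 'rV[R]_n -> R) : Prop := forall k, Ck k U F.

Definition smooth_on_vec (R : realType) (n p : nat) (U : set 'rV[R]_n)
  (F : 'rV[R]_n -> 'rV[R]_p) : Prop :=
  forall j : 'I_p, smooth_on U (fun y => F y 0 j).

(* A smooth manifold of dimension n, presented by a smooth atlas (not
   necessarily maximal).  [param i] is a total function whose values matter
   only on the open set [chart i @` dom i], where it is the inverse of
   [chart i].  The preferred chart [chart_at x] around x is only used to
   represent tangent vectors at x by coordinates. *)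
Record manifold (R : realType) (n : nat) := Manifold {
  carrier :> topologicalType;
  manifold_hausdorff : hausdorff_space carrier;
  manifold_second_countable : @second_countable carrier;
  chart_index : Type;
  dom : chart_index -> set carrier;
  chart : chart_index -> carrier -> 'rV[R]_n;
  param : chart_index -> 'rV[R]_n -> carrier;
  chart_at : carrier -> chart_index;
  dom_open : forall i, open (dom i);
  dom_chart_at : forall x, dom (chart_at x) x;
  chart_image_open : forall i, open (chart i @` dom i);
  chartK : forall i x, dom i x -> param i (chart i x) = x;
  chart_continuous : forall i x, dom i x -> {for x, continuous (chart i)};
  param_continuous : forall i y, (chart i @` dom i) y ->
    {for y, continuous (param i)};
  transition_smooth : forall i j,
    smooth_on_vec (chart i @` (dom i `&` dom j)) (chart j \o param i)
}.

(* The tangent space at x: the coordinate vectors in the preferred chart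
   around x. *)
Definition tangent (R : realType) (n : nat) (X : manifold R n) (x : X)
  : vectType R := 'rV[R]_n.

(* The coordinates in chart i of tangent vectors at x, and conversely the
   tangent vectors at x with given coordinates in chart i, for x in [dom i].
   Vectors are rows and the Jacobian acts by right multiplication. *)
Definition to_chart (R : realType) (n : nat) (X : manifold R n)
    (i : chart_index X) (x : X) : 'Hom(tangent x, 'rV[R]_n) :=
  linfun (mulmxr (jacobian (chart i \o param (chart_at x))
                           (chart (chart_at x) x))).

Definition of_chart (R : realType) (n : nat) (X : manifold R n)
    (i : chart_index X) (x : X) : 'Hom('rV[R]_n, tangent x) :=
  linfun (mulmxr (jacobian (chart (chart_at x) \o param i) (chart i x))).

Definition coord_vector (R : realType) (n : nat) (X : manifold R n)
    (i : chart_index X) (x : X) (k : 'I_n) : tangent x :=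
  of_chart i x (delta_mx 0 k).

Definition smooth_function (R : realType) (n : nat) (X : manifold R n)
    (h : X -> R) : Prop :=
  forall i : chart_index X, smooth_on (chart i @` dom i) (h \o param i).

Definition smooth_map (R : realType) (m n : nat) (X : manifold R m)
    (Y : manifold R n) (f : X -> Y) : Prop :=
  continuous f /\
  forall (i : chart_index X) (j : chart_index Y),
    smooth_on_vec (chart i @` (dom i `&` f @^-1` dom j))
                  (chart j \o f \o param i).

Definition differential (R : realType) (m n : nat) (X : manifold R m)
    (Y : manifold R n) (f : X -> Y) (x : X)
    : 'Hom(tangent x, tangent (f x)) :=
  linfun (mulmxr (jacobian (chart (chart_at (f x)) \o f \o param (chart_at x))
                           (chart (chart_at x) x))).

Definition injective_immersion (R : realType) (m n : nat) (X : manifold R m)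
    (Y : manifold R n) (f : X -> Y) : Prop :=
  [/\ injective f, smooth_map f & forall x, lker (differential f x) = 0%VS].

(* The tangent space of the immersed submanifold (X, f), as a subspace of the
   tangent space of the ambient manifold. *)
Definition tangent_sub (R : realType) (m n : nat) (X : manifold R m)
    (Y : manifold R n) (f : X -> Y) (x : X) : {vspace tangent (f x)} :=
  limg (differential f x).

Record riemannian_metric (R : realType) (n : nat) (X : manifold R n) :=
  RiemannianMetric {
  metric :> forall x : X, tangent x -> tangent x -> R;
  metric_linear : forall x (c : R) (u v w : tangent x),
    metric (c *: u + v) w = c * metric u w + metric v w;
  metric_sym : forall x (u v : tangent x), metric u v = metric v u;
  metric_pos : forall x (v : tangent x), v != 0 -> 0 < metric v v;
  metric_smooth : forall (i : chart_index X) (j k : 'I_n),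
    smooth_on (chart i @` dom i)
      (fun y => metric (coord_vector i (param i y) j)
                       (coord_vector i (param i y) k))
}.

Definition endo_field (R : realType) (n : nat) (X : manifold R n) :=
  forall x : X, 'End(tangent x).

Definition smooth_endo_field (R : realType) (n : nat) (X : manifold R n)
    (J : endo_field X) : Prop :=
  forall (i : chart_index X) (j k : 'I_n),
    smooth_on (chart i @` dom i)
      (fun y => to_chart i (param i y)
                  (J (param i y) (coord_vector i (param i y) j)) 0 k).

Definition almost_complex (R : realType) (n : nat) (X : manifold R n)
    (J : endo_field X) : Prop :=
  smooth_endo_field J /\ forall x, (J x \o J x)%VF = - \1%VF.

Definition almost_hermitian (R : realType) (n : nat) (X : manifold R n)
    (g : riemannian_metric X) (J : endo_field X) : Prop :=
  almost_complex J /\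
  forall x (u v : tangent x), g x (J x u) v = - g x u (J x v).

Definition anti_commute (R : realType) (n : nat) (X : manifold R n)
    (J1 J2 : endo_field X) : Prop :=
  forall x, (J1 x \o J2 x)%VF = - (J2 x \o J1 x)%VF.

Definition endo_comb (R : realType) (n : nat) (X : manifold R n)
    (a b : X -> R) (J1 J2 : endo_field X) : endo_field X :=
  fun x => a x *: J1 x + b x *: J2 x.

Section Angles.
Variables (R : realType) (n : nat) (X : manifold R n).
Variable g : riemannian_metric X.

Definition metric_norm (x : X) (v : tangent x) : R := Num.sqrt (g x v v).

Definition vector_angle (x : X) (v w : tangent x) : R :=
  acos (g x v w / (metric_norm v * metric_norm w)).

(* The angle between a nonzero vector v and a nonzero subspace W. *)
Definition subspace_angle (x : X) (v : tangent x) (W : {vspace tangent x})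
    : R :=
  inf [set vector_angle v w | w in [set w : tangent x | w \in W /\ w != 0]].

(* The component of v in W along the g-orthogonal complement of W (which is
   the unique element of the set below). *)
Definition tan_part (x : X) (W : {vspace tangent x}) (v : tangent x)
    : tangent x :=
  xget 0 [set w : tangent x |
    w \in W /\ forall w' : tangent x, w' \in W -> g x (v - w) w' = 0].

End Angles.

(* For v tangent to the immersed submanifold (X, f) at x, the vector [T v],
   i.e. the tangential component of [J v]. *)
Definition slantT (R : realType) (m n : nat) (X : manifold R m)
    (Y : manifold R n) (g : riemannian_metric Y) (f : X -> Y)
    (J : endo_field Y) (x : X) (v : tangent (f x)) : tangent (f x) :=
  tan_part g (tangent_sub f x) (J (f x) v).
Arguments slantT {R m n X Y} g f J x v.

(* The angle between J v and the tangent space of the submanifold at x is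
   theta x for all nonzero tangent v; theta x = 0 is not excluded. *)
Definition has_slant_angle (R : realType) (m n : nat) (X : manifold R m)
    (Y : manifold R n) (g : riemannian_metric Y) (f : X -> Y)
    (J : endo_field Y) (theta : X -> R) : Prop :=
  forall (x : X) (v : tangent (f x)), v \in tangent_sub f x -> v != 0 ->
    subspace_angle g (J (f x) v) (tangent_sub f x) = theta x.

Definition pointwise_slant (R : realType) (m n : nat) (X : manifold R m)
    (Y : manifold R n) (g : riemannian_metric Y) (f : X -> Y)
    (J : endo_field Y) (theta : X -> R) : Prop :=
  (forall x, 0 < theta x <= pi / 2) /\ has_slant_angle g f J theta.

(* Main.v *)
Require Import Defs.
From HB Require Import structures.
From mathcomp Require Import all_boot all_order all_algebra.
From mathcomp Require Import ring lra.
From mathcomp Require Import all_classical all_reals all_analysis.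
Import Order.TTheory GRing.Theory Num.Theory.
Import numFieldNormedType.Exports.
Local Open Scope classical_set_scope.
Local Open Scope ring_scope.

Set Implicit Arguments.
Unset Strict Implicit.
Unset Printing Implicit Defensive.

(** The slant condition is pointwise linear algebra.  Let W be the tangent
    space of the submanifold at a point, T the composite of an orthogonal
    almost complex structure J with the orthogonal projection onto W.  By
    Cauchy-Schwarz, among the nonzero w in W the cosine of the angle between
    J u and w is largest at w = T u, so for a unit vector u in W the angle
    between J u and W is acos |T u| ([subspace_angleE], [slant_angleZ]).
    Since acos is injective on [0, 1], a slant angle exists exactly when |T u|
    is the same for all unit u in W ([has_slant_angleP], [slant_functionP]),
    and then cos theta = |T u| ([cos_slant]).

    For J = a J1 + b J2 the projection being linear gives T = a T1 + b T2, so
      |T u|^2 = a^2 cos^2 theta1 + b^2 cos^2 theta2 + 2 a b g(T1 u, T2 u)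
    ([slantT_comb_sqr]).  Only the last term can depend on u, and it does so
    through g(T1 u, T2 u) unless a b = 0: this is the equivalence, and taking
    square roots is the formula for theta.  The angle is 0 exactly when
    |T u| = |J u|, which by Pythagoras means that J u lies in W; this accounts
    for the extra condition that separates slant functions valued in (0, pi/2]
    from those that may vanish.

    That a J1 + b J2 is again almost Hermitian ([almost_hermitian_comb]) uses
    the anti-commutation to cancel the cross terms of its square, and the
    closure of smooth functions under sums and products. *)

(** * Sums and products of smooth functions *)

Section Smoothness.
Variables (R : realType) (n : nat) (U : set 'rV[R]_n).
Hypothesis openU : open U.
Implicit Types F G : 'rV[R]_n -> R.

(** Differentiability at y says that F (y + h) is F y plus a continuous linear
    map plus o(h), and the o(h) only sees F near y. *)
Lemma near_eq_differentiable F G y :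
  (\near y, F y = G y) -> differentiable F y -> differentiable G y.
Proof.
move=> FG dF; have [cdF eF] := (diff_locallyP y F).1 dF.
have Fy : F y = G y by exact: (nbhs_singleton FG).
have eG : G \o shift y = cst (G y) + 'd F y +o_ 0 id.
  apply/eqaddoP => _/posnumP[e].
  have /eqaddoP/(_ e%:num (gt0 e)) := eF.
  have : \forall z \near (0 : 'rV[R]_n), (F \o shift y) z = (G \o shift y) z.
    have := FG; rewrite (near_shift 0 y) subr0.
    by apply: filterS => z; rewrite /= addrC.
  by apply: filterS2 => z; rewrite /= !fctE /= => <-; rewrite Fy.
by apply/diff_locallyP; rewrite (diff_unique cdF eG).
Qed.

Lemma near_open_eq F G y : (forall z, U z -> F z = G z) -> U y ->
  \near y, F y = G y.
Proof.
move=> FG Uy; have : nbhs y U by exact: open_nbhs_nbhs.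
by apply: filterS => z /FG.
Qed.

(** The recursion defining [Ck] iterates derivatives that are total functions,
    and the rules for the derivative of a sum or a product hold only where both
    terms are differentiable, that is on U.  Replacing a function by one that
    agrees with it on U is what lets the induction go through, and openness of
    U makes agreement on U a local property at each of its points. *)
Lemma Ck_eq k F G : (forall y, U y -> F y = G y) -> Ck k U F -> Ck k U G.
Proof.
elim: k F G => [|k IH] F G FG /=.
  move=> cF y Uy; rewrite /prop_for /continuous_at -(FG y Uy).
  exact: cvg_trans (near_eq_cvg (near_open_eq FG Uy)) (cF y Uy).
case=> dF DF; split=> [y Uy|i].
  exact: near_eq_differentiable (near_open_eq FG Uy) (dF y Uy).
apply: (IH ('D_(delta_mx 0 i) F)) => // y Uy.
by apply: near_eq_derive; exact: near_open_eq.
Qed.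

Lemma CkS k F : Ck k.+1 U F -> Ck k U F.
Proof.
elim: k F => [|k IH] F [dF DF]; first by move=> y /dF/differentiable_continuous.
by split=> // i; apply: IH.
Qed.

Lemma CkD k F G : Ck k U F -> Ck k U G -> Ck k U (F + G).
Proof.
elim: k F G => [|k IH] F G.
  by move=> cF cG y Uy; apply: continuousD; [apply: cF|apply: cG].
case=> dF DF [dG DG]; split=> [y Uy|i].
  by apply: differentiableD; [apply: dF|apply: dG].
apply: Ck_eq (IH _ _ (DF i) (DG i)) => y Uy.
by rewrite deriveD //; apply: diff_derivable; [apply: dF|apply: dG].
Qed.

(** The derivative F DG + G DF involves the undifferentiated factors, which
    are of class C^k by [CkS]. *)
Lemma CkM k F G : Ck k U F -> Ck k U G -> Ck k U (F * G).
Proof.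
elim: k F G => [|k IH] F G.
  by move=> cF cG y Uy; apply: continuousM; [apply: cF|apply: cG].
move=> CF CG; have [dF DF] := CF; have [dG DG] := CG; split=> [y Uy|i].
  by apply: differentiableM; [apply: dF|apply: dG].
apply: Ck_eq (CkD (IH _ _ (CkS CF) (DG i)) (IH _ _ (CkS CG) (DF i))) => y Uy.
by rewrite deriveM //; apply: diff_derivable; [apply: dF|apply: dG].
Qed.

Lemma smooth_onD F G : smooth_on U F -> smooth_on U G -> smooth_on U (F + G).
Proof. by move=> sF sG k; apply: CkD. Qed.

Lemma smooth_onM F G : smooth_on U F -> smooth_on U G -> smooth_on U (F * G).
Proof. by move=> sF sG k; apply: CkM. Qed.

End Smoothness.

(** * Orthogonal projection and the angle with a subspace *)

Lemma le_acos (R : realType) (s t : R) :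
  -1 <= s -> s <= t -> t <= 1 -> acos t <= acos s.
Proof.
move=> s1 st t1.
have itv r : -1 <= r -> r <= 1 -> acos r \in `[0, pi].
  by move=> ? ?; rewrite in_itv /= acos_ge0 ?acos_lepi //; apply/andP.
rewrite leNgt -ltr_cos ?itv ?(le_trans st) ?(le_trans s1) //.
rewrite !acosK ?in_itv /= -?leNgt //; apply/andP; lra.
Qed.

Section Pointwise.
Variables (R : realType) (n : nat) (X : manifold R n).
Variables (g : riemannian_metric X) (x : X).
Implicit Types (u v w : tangent x) (W : {vspace tangent x}).

Lemma metricDl u v w : g x (u + v) w = g x u w + g x v w.
Proof. by rewrite -{1}[u]scale1r metric_linear mul1r. Qed.

Lemma metric0l w : g x 0 w = 0.
Proof. by have := metricDl 0 0 w; rewrite addr0 -{1}[g x 0 w]addr0 => /addrI. Qed.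

Lemma metricZl c v w : g x (c *: v) w = c * g x v w.
Proof. by rewrite -[c *: v]addr0 metric_linear metric0l addr0. Qed.

Lemma metricDr u v w : g x w (u + v) = g x w u + g x w v.
Proof. by rewrite Defs.metric_sym metricDl !(Defs.metric_sym _ w). Qed.

Lemma metric0r w : g x w 0 = 0.
Proof. by rewrite Defs.metric_sym metric0l. Qed.

Lemma metricZr c v w : g x w (c *: v) = c * g x w v.
Proof. by rewrite Defs.metric_sym metricZl Defs.metric_sym. Qed.

Lemma metricNl v w : g x (- v) w = - g x v w.
Proof. by rewrite -scaleN1r metricZl mulN1r. Qed.

Lemma metricNr v w : g x w (- v) = - g x w v.
Proof. by rewrite -scaleN1r metricZr mulN1r. Qed.

Lemma metric_ge0 v : 0 <= g x v v.
Proof.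
have [->|/(metric_pos g)/ltW//] := eqVneq v 0; by rewrite metric0l.
Qed.

Lemma metric_eq0 v : (g x v v == 0) = (v == 0).
Proof.
have [->|v0] := eqVneq v 0; first by rewrite metric0l eqxx.
by rewrite gt_eqF // metric_pos.
Qed.

Lemma metric_norm_ge0 v : 0 <= metric_norm g v.
Proof. exact: sqrtr_ge0. Qed.

Lemma metric_norm_sqr v : metric_norm g v ^+ 2 = g x v v.
Proof. by rewrite sqr_sqrtr // metric_ge0. Qed.

Lemma metric_norm_gt0 v : (0 < metric_norm g v) = (v != 0).
Proof. by rewrite sqrtr_gt0 lt_def metric_ge0 andbT metric_eq0. Qed.

Lemma metric_normZ c v : metric_norm g (c *: v) = `|c| * metric_norm g v.
Proof.
by rewrite /metric_norm metricZl metricZr mulrA -expr2 sqrtrM ?sqr_ge0 // sqrtr_sqr.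
Qed.

Lemma cauchy_schwarz v w : `|g x v w| <= metric_norm g v * metric_norm g w.
Proof.
rewrite -[leLHS]sqrtr_sqr -sqrtrM ?metric_ge0 // ler_wsqrtr //.
have [->|w0] := eqVneq w 0; first by rewrite !metric0r mulr0 expr0n.
have := metric_ge0 (g x w w *: v - g x v w *: w).
rewrite !(metricDl, metricDr, metricNl, metricNr, metricZl, metricZr).
rewrite (Defs.metric_sym g w v); have := metric_pos g w0.
set A := g x v v; set B := g x v w; set C := g x w w => C0 h.
(* The square of the norm of C v - B w is C (A C - B^2). *)
rewrite -(ler_pM2l C0) -subr_ge0; apply: le_trans h _.
rewrite le_eqVlt; apply/orP; left; apply/eqP; ring.
Qed.

(** Gram-Schmidt, by induction on a sequence e :: s spanning W: if r is the
    part of e orthogonal to the span of s, the projection of v is its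
    projection onto the span of s plus its component along r. *)
Lemma orthogonal_projection_exists W v :
  exists w, w \in W /\ forall w', w' \in W -> g x (v - w) w' = 0.
Proof.
rewrite -(span_basis (vbasisP W)).
elim: (vbasis W : seq _) v => [|e s IH] v.
  exists 0; split=> [|w']; first exact: mem0v.
  by rewrite span_nil memv0 => /eqP ->; rewrite metric0r.
have [p [ps ep]] := IH e; have [q [qs vq]] := IH v.
pose r := e - p.
have mems w' : w' \in span (e :: s) -> exists c t, t \in span s /\ w' = c *: r + t.
  rewrite span_cons => /memv_addP[_ /vlineP[c ->] [t ts ->]].
  exists c, (c *: p + t); split; first by rewrite memvD // memvZ.
  by rewrite /r scalerBr addrA subrK.
have res : r \in span (e :: s).
  by rewrite span_cons memv_add // ?memv_line // memvN.
(* If r = 0 then c = 0, as division by 0 is 0, and e adds nothing to the span. *)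
pose c := g x v r / g x r r.
exists (q + c *: r); split.
  rewrite memvD ?memvZ //.
  by rewrite span_cons -[q]add0r memv_add ?mem0v.
move=> _ /mems[d [t [ts ->]]].
have qr : g x q r = 0 by rewrite Defs.metric_sym; exact: ep.
have rt : g x r t = 0 by exact: ep.
rewrite opprD addrA metricDl metricNl metricZl !metricDr !metricZr (vq t ts) rt.
rewrite metricDl metricNl qr subr0 !addr0.
have [r0|r0] := eqVneq r 0; first by rewrite r0 !metric0r; ring.
have : g x r r != 0 by rewrite metric_eq0.
by rewrite /c => ?; field.
Qed.

Lemma tan_partP W v :
  tan_part g W v \in W /\ forall w, w \in W -> g x (v - tan_part g W v) w = 0.
Proof. exact: xgetPex (orthogonal_projection_exists W v). Qed.

Lemma tan_part_mem W v : tan_part g W v \in W.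
Proof. by case: (tan_partP W v). Qed.

Lemma metric_tan_part W v w : w \in W -> g x (tan_part g W v) w = g x v w.
Proof.
move=> Ww; have [_ /(_ w Ww)] := tan_partP W v.
by rewrite metricDl metricNl => /subr0_eq.
Qed.

(** If w and the projection of v have the same products with W, their
    difference d lies in W and is orthogonal to W, in particular to itself. *)
Lemma tan_part_unique W v w : w \in W ->
  (forall w', w' \in W -> g x w w' = g x v w') -> tan_part g W v = w.
Proof.
move=> Ww vw; apply/eqP; rewrite -subr_eq0; set d := (_ - w).
have Wd : d \in W by rewrite memvB // tan_part_mem.
by rewrite -metric_eq0 {1}/d metricDl metricNl metric_tan_part // vw // subrr.
Qed.

Lemma tan_part_id W v : v \in W -> tan_part g W v = v.
Proof. by move=> Wv; apply: tan_part_unique. Qed.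

Lemma tan_part_comb W c d v w :
  tan_part g W (c *: v + d *: w) = c *: tan_part g W v + d *: tan_part g W w.
Proof.
apply: tan_part_unique => [|w' Ww'].
  by rewrite memvD // memvZ // tan_part_mem.
by rewrite !metricDl !metricZl !metric_tan_part.
Qed.

Lemma tan_partZ W c v : tan_part g W (c *: v) = c *: tan_part g W v.
Proof. by have := tan_part_comb W c 0 v 0; rewrite !scale0r !addr0. Qed.

Lemma tan_part_pythagoras W v : g x v v =
  g x (tan_part g W v) (tan_part g W v) +
  g x (v - tan_part g W v) (v - tan_part g W v).
Proof.
set t := tan_part g W v.
have := metric_tan_part v (tan_part_mem W v); rewrite -/t.
by rewrite !(metricDl, metricDr, metricNl, metricNr) (Defs.metric_sym g t v); lra.
Qed.

Lemma tan_part_norm_le W v : metric_norm g (tan_part g W v) <= metric_norm g v.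
Proof. by apply: ler_wsqrtr; rewrite (tan_part_pythagoras W v) lerDl metric_ge0. Qed.

Lemma tan_part_norm_lt W v : v \notin W ->
  metric_norm g (tan_part g W v) < metric_norm g v.
Proof.
move=> NWv; have Nvt : v - tan_part g W v != 0.
  by apply: contra NWv => /eqP/subr0_eq ->; exact: tan_part_mem.
rewrite ltr_sqrt (tan_part_pythagoras W v) ?ltrDl ?metric_pos //.
by rewrite ltr_wpDl ?metric_ge0 ?metric_pos.
Qed.

Lemma cos_quot_itv v w :
  -1 <= g x v w / (metric_norm g v * metric_norm g w) <= 1.
Proof.
have := cauchy_schwarz v w.
have : 0 <= metric_norm g v * metric_norm g w by rewrite mulr_ge0 ?metric_norm_ge0.
rewrite le_eqVlt => /orP[/eqP <- _|p0]; first by rewrite invr0 mulr0; lra.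
by rewrite ler_norml ler_pdivlMr // ler_pdivrMr // mulN1r mul1r.
Qed.

(** For w in W, g v w = g t w <= |t| |w| where t is the projection of v, so no
    angle is smaller than acos (|t| / |v|).  This bound is reached at w = t if
    t is nonzero; otherwise v is orthogonal to W and every nonzero w reaches
    it. *)
Lemma subspace_angleE W v : v != 0 -> W != 0%VS ->
  subspace_angle g v W = acos (metric_norm g (tan_part g W v) / metric_norm g v).
Proof.
move=> v0 W0; rewrite /subspace_angle; set A := (X in inf X).
set t := tan_part g W v.
have nv : 0 < metric_norm g v by rewrite metric_norm_gt0.
have tv : metric_norm g t / metric_norm g v <= 1.
  by rewrite ler_pdivrMr // mul1r tan_part_norm_le.
have lbA : lbound A (acos (metric_norm g t / metric_norm g v)).
  move=> _ [w [Ww w0] <-]; apply: le_acos.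
  - by have /andP[] := cos_quot_itv v w.
  - have nw : 0 < metric_norm g w by rewrite metric_norm_gt0.
    rewrite ler_pdivrMr ?mulr_gt0 // mulrA divfK ?gt_eqF //.
    rewrite -(metric_tan_part v Ww).
    exact: le_trans (ler_norm _) (cauchy_schwarz _ _).
  - exact: tv.
suff At : A (acos (metric_norm g t / metric_norm g v)).
  apply/le_anti/andP; split; first by apply: ge_inf => //; eexists; exact: lbA.
  by apply: lb_le_inf => //; eexists; exact: At.
have [t0|t0] := eqVneq t 0.
  exists (vpick W); first by split; [exact: memv_pick | rewrite vpick0].
  rewrite /vector_angle -(metric_tan_part v (memv_pick W)) -/t t0.
  by rewrite metric0l /metric_norm metric0l sqrtr0 !mul0r.
exists t; first by split=> //; exact: tan_part_mem.
have nt : metric_norm g t != 0 by rewrite gt_eqF // metric_norm_gt0.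
rewrite /vector_angle -(metric_tan_part v (tan_part_mem W v)) -/t -metric_norm_sqr.
by congr acos; field; rewrite nt gt_eqF.
Qed.

End Pointwise.

(** * Combinations of anti-commuting almost Hermitian structures *)

Section Hermitian.
Variables (R : realType) (n : nat) (X : manifold R n) (g : riemannian_metric X).

Lemma almost_complexK (J : endo_field X) x (v : tangent x) :
  almost_complex J -> J x (J x v) = - v.
Proof.
by move=> [_ /(_ x)/lfunP/(_ v)]; rewrite comp_lfunE opp_lfunE id_lfunE.
Qed.

(** J is an isometry: g (J v) (J v) = - g v (J (J v)) = g v v. *)
Lemma almost_hermitian_norm (J : endo_field X) x (v : tangent x) :
  almost_hermitian g J -> metric_norm g (J x v) = metric_norm g v.
Proof.
move=> [JJ skew]; rewrite /metric_norm skew almost_complexK //.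
by rewrite metricNr opprK.
Qed.

Lemma hom_comb (V W : vectType R) (h : 'Hom(V, W)) c d u v :
  h (c *: u + d *: v) = c *: h u + d *: h v.
Proof. by rewrite linearD !linearZ. Qed.

(** Over an arbitrary vector space V, so that it applies to [to_chart] without
    the Jacobian in it being unfolded. *)
Lemma hom_comb_coord (V : vectType R) (h : 'Hom(V, 'rV[R]_n)) (A B : 'End(V))
    c d e k :
  h ((c *: A + d *: B) e) 0 k = c * h (A e) 0 k + d * h (B e) 0 k.
Proof. by rewrite add_lfunE !scale_lfunE hom_comb !mxE. Qed.

Lemma smooth_endo_comb (a b : X -> R) (J1 J2 : endo_field X) :
  smooth_function a -> smooth_function b ->
  smooth_endo_field J1 -> smooth_endo_field J2 ->
  smooth_endo_field (endo_comb a b J1 J2).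
Proof.
move=> sa sb s1 s2 i j k; have oU := @chart_image_open _ _ X i.
pose D h y := to_chart i (param i y) (h (param i y) (coord_vector i (param i y) j)) 0 k.
have := smooth_onD oU (smooth_onM oU (sa i) (s1 i j k))
                      (smooth_onM oU (sb i) (s2 i j k)).
suff -> : (a \o param i) * D J1 + (b \o param i) * D J2 = D (endo_comb a b J1 J2).
  by [].
apply/funext => y; rewrite /D /endo_comb.
exact/esym/hom_comb_coord.
Qed.

Lemma almost_hermitian_comb (a b : X -> R) (J1 J2 : endo_field X) :
  smooth_function a -> smooth_function b ->
  (forall x, a x ^+ 2 + b x ^+ 2 = 1) ->
  almost_hermitian g J1 -> almost_hermitian g J2 -> anti_commute J1 J2 ->
  almost_hermitian g (endo_comb a b J1 J2).
Proof.
move=> sa sb ab1 h1 h2 ac.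
have [ac1 skew1] := h1; have [ac2 skew2] := h2.
split; first split.
- by apply: smooth_endo_comb => //; [case: ac1|case: ac2].
- move=> x; apply/lfunP => v.
  have J12 : J1 x (J2 x v) = - J2 x (J1 x v).
    by have /lfunP/(_ v) := ac x; rewrite opp_lfunE !comp_lfunE.
  rewrite comp_lfunE opp_lfunE id_lfunE /endo_comb.
  rewrite !(add_lfunE, scale_lfunE) !hom_comb.
  rewrite !almost_complexK // J12 -[in RHS](scale1r v) -(ab1 x).
  rewrite !scalerN !scalerDr !scalerN !scalerA (mulrC (b x) (a x)) scalerDl.
  rewrite !expr2 opprD addrACA -addrA; congr (_ + _).
  by rewrite addrA subrr add0r.
- move=> x u v; rewrite /endo_comb !(add_lfunE, scale_lfunE).
  by rewrite metricDl metricDr !metricZl !metricZr skew1 skew2; ring.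
Qed.

End Hermitian.

(** * Slant functions as norms of tangential parts *)

Section Slant.
Variables (R : realType) (m n : nat) (Y : manifold R n) (g : riemannian_metric Y).
Variables (X : manifold R m) (f : X -> Y).

Definition unit_tangent x (u : tangent (f x)) :=
  u \in tangent_sub f x /\ metric_norm g u = 1.

Lemma unit_tangentP x (v : tangent (f x)) : v \in tangent_sub f x -> v != 0 ->
  exists c u, [/\ c != 0, unit_tangent u & v = c *: u].
Proof.
move=> Wv v0; have nv : metric_norm g v != 0 by rewrite gt_eqF // metric_norm_gt0.
exists (metric_norm g v), ((metric_norm g v)^-1 *: v); split=> //; last first.
  by rewrite scalerA divff // scale1r.
split; first by rewrite memvZ.
by rewrite metric_normZ ger0_norm ?invr_ge0 ?metric_norm_ge0 // mulVf.
Qed.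

Lemma unit_tangent_neq0 x (u : tangent (f x)) : unit_tangent u -> u != 0.
Proof. by case=> _ u1; rewrite -(metric_norm_gt0 g) u1 ltr01. Qed.

Section OneStructure.
Variables (J : endo_field Y) (hJ : almost_hermitian g J).
Local Notation T := (slantT g f J).

Lemma slantT_norm_le1 x (u : tangent (f x)) : unit_tangent u ->
  metric_norm g (T x u) <= 1.
Proof.
by case=> _ <-; rewrite -(almost_hermitian_norm u hJ); exact: tan_part_norm_le.
Qed.

Lemma slantT_norm_itv x (u : tangent (f x)) : unit_tangent u ->
  -1 <= metric_norm g (T x u) <= 1.
Proof.
move=> ut; rewrite slantT_norm_le1 // andbT.
by rewrite (le_trans _ (metric_norm_ge0 _ _)) // lerN10.
Qed.

Lemma slantT_norm_lt1 x (u : tangent (f x)) : unit_tangent u ->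
  J (f x) u \notin tangent_sub f x -> metric_norm g (T x u) < 1.
Proof.
by case=> _ <-; rewrite -(almost_hermitian_norm u hJ); exact: tan_part_norm_lt.
Qed.

Lemma slantTZ x c (u : tangent (f x)) : T x (c *: u) = c *: T x u.
Proof. by rewrite /slantT linearZ tan_partZ. Qed.

(** The scalar c lets every nonzero tangent vector be reduced to a unit one:
    both the norm of T v and that of J v scale by |c|. *)
Lemma slant_angleZ x c (u : tangent (f x)) : c != 0 -> unit_tangent u ->
  subspace_angle g (J (f x) (c *: u)) (tangent_sub f x) =
  acos (metric_norm g (T x u)).
Proof.
move=> c0 ut; have [Wu u1] := ut.
have W0 : tangent_sub f x != 0%VS.
  by apply: contraTneq Wu => ->; rewrite memv0 unit_tangent_neq0.
have c1 : metric_norm g (c *: u) = `|c| by rewrite metric_normZ u1 mulr1.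
have Jcu : J (f x) (c *: u) != 0.
  by rewrite -(metric_norm_gt0 g) almost_hermitian_norm // c1 normr_gt0.
rewrite subspace_angleE // almost_hermitian_norm // c1.
rewrite -[tan_part _ _ _]/(T x (c *: u)) slantTZ metric_normZ mulrC mulKf //.
by rewrite normr_eq0.
Qed.

Lemma has_slant_angleP theta : has_slant_angle g f J theta <->
  forall x (u : tangent (f x)), unit_tangent u ->
    theta x = acos (metric_norm g (T x u)).
Proof.
split=> h x u.
  move=> ut; rewrite -(slant_angleZ (oner_neq0 R) ut) scale1r.
  by rewrite h ?unit_tangent_neq0 //; case: ut.
move=> Wu u0; have [c [e [c0 et ->]]] := unit_tangentP Wu u0.
by rewrite slant_angleZ // -h.
Qed.

Lemma cos_slant theta x (u : tangent (f x)) :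
  has_slant_angle g f J theta -> unit_tangent u ->
  cos (theta x) = metric_norm g (T x u).
Proof.
move=> /has_slant_angleP h ut; rewrite (h _ _ ut) acosK //.
by rewrite in_itv /= slantT_norm_itv.
Qed.

(** The angle measured at one arbitrary unit vector.  Where the tangent space is
    zero there is no unit vector, [xget] returns 0, and the value is
    acos 0 = pi / 2, which stays in the range required of a slant function. *)
Definition slant_function x : R :=
  acos (metric_norm g (T x (xget 0 (@unit_tangent x)))).

Lemma slant_functionP :
  (forall x (u u' : tangent (f x)), unit_tangent u -> unit_tangent u' ->
     metric_norm g (T x u) = metric_norm g (T x u')) ->
  has_slant_angle g f J slant_function.
Proof.
move=> cst; apply/has_slant_angleP => x u ut.
by congr acos; apply: cst => //; exact: xgetI ut.
Qed.

(** |T u| < 1 = |J u| by Pythagoras as soon as J u is not tangent, and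
    |T u| >= 0, so the angle is in (0, pi / 2]. *)
Lemma slant_function_itv :
  (forall x (u : tangent (f x)), unit_tangent u ->
     J (f x) u \notin tangent_sub f x) ->
  forall x, 0 < slant_function x <= pi / 2.
Proof.
move=> NW x; rewrite /slant_function; set u := xget _ _.
have Tu1 : metric_norm g (T x u) < 1.
  rewrite /u; case: xgetP => [e _ et|_]; first exact: slantT_norm_lt1 (NW _ _ et).
  by rewrite -[0](scale0r 0) slantTZ scale0r /metric_norm metric0l sqrtr0 ltr01.
have Tu0 := metric_norm_ge0 g (T x u).
apply/andP; split; first by apply: acos_gt0; apply/andP; split => //; lra.
by rewrite -acos0; apply: le_acos => //; lra.
Qed.

(** If J u were tangent then |T u| = |J u| = 1 and the angle would be 0. *)
Lemma slant_gt0_notin theta x (u : tangent (f x)) :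
  has_slant_angle g f J theta -> 0 < theta x -> unit_tangent u ->
  J (f x) u \notin tangent_sub f x.
Proof.
move=> /has_slant_angleP h + ut; rewrite (h _ _ ut); apply: contraTN => WJu.
by rewrite /slantT tan_part_id // almost_hermitian_norm // ut.2 acos1 ltxx.
Qed.

End OneStructure.

(** Because the projection is linear, the
    tangential part of (a J1 + b J2) u is a T1 u + b T2 u. *)
Lemma slantT_comb_sqr (a b : Y -> R) (J1 J2 : endo_field Y) x (u : tangent (f x)) :
  metric_norm g (slantT g f (endo_comb a b J1 J2) x u) ^+ 2 =
  a (f x) ^+ 2 * metric_norm g (slantT g f J1 x u) ^+ 2 +
  b (f x) ^+ 2 * metric_norm g (slantT g f J2 x u) ^+ 2 +
  2 * a (f x) * b (f x) * g (f x) (slantT g f J1 x u) (slantT g f J2 x u).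
Proof.
rewrite !metric_norm_sqr /slantT /endo_comb add_lfunE !scale_lfunE tan_part_comb.
set t1 := tan_part _ _ _; set t2 := tan_part _ _ _.
rewrite !(metricDl, metricDr, metricZl, metricZr) (Defs.metric_sym g t2 t1).
ring.
Qed.

End Slant.

(** * The slant condition for the combined structure *)

Theorem theorem3p1 (R : realType) (n m : nat)
    (Mbar : manifold R n) (g : riemannian_metric Mbar)
    (J1 J2 : endo_field Mbar)
    (hJ1 : almost_hermitian g J1) (hJ2 : almost_hermitian g J2)
    (hJ12 : anti_commute J1 J2)
    (M : manifold R m) (f : M -> Mbar) (hf : injective_immersion f)
    (theta1 theta2 : M -> R)
    (hM1 : pointwise_slant g f J1 theta1)
    (hM2 : pointwise_slant g f J2 theta2)
    (a b : Mbar -> R) (ha : smooth_function a) (hb : smooth_function b)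
    (hab : forall x, a x ^+ 2 + b x ^+ 2 = 1) :
  let Jab := endo_comb a b J1 J2 in
  let T1 := slantT g f J1 in
  let T2 := slantT g f J2 in
  let constant_product :=
    forall x : M, a (f x) * b (f x) != 0 ->
    forall u u' : tangent (f x),
      u \in tangent_sub f x -> metric_norm g u = 1 ->
      u' \in tangent_sub f x -> metric_norm g u' = 1 ->
      g (f x) (T1 x u) (T2 x u) = g (f x) (T1 x u') (T2 x u') in
  [/\ almost_hermitian g Jab,
      (exists theta : M -> R, has_slant_angle g f Jab theta)
        <-> constant_product,
      (exists theta : M -> R, pointwise_slant g f Jab theta)
        <-> constant_product /\
            (forall (x : M) (v : tangent (f x)), v \in tangent_sub f x ->
               v != 0 -> Jab (f x) v \notin tangent_sub f x) &
      forall theta : M -> R, has_slant_angle g f Jab theta ->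
      forall (x : M) (u : tangent (f x)),
        u \in tangent_sub f x -> metric_norm g u = 1 ->
        theta x =
          acos (Num.sqrt (a (f x) ^+ 2 * cos (theta1 x) ^+ 2
                          + b (f x) ^+ 2 * cos (theta2 x) ^+ 2
                          + 2 * a (f x) * b (f x)
                            * g (f x) (T1 x u) (T2 x u)))].
Proof.
move=> Jab T1 T2 constant_product.
have hJab : almost_hermitian g Jab by exact: almost_hermitian_comb.
have [_ s1] := hM1; have [_ s2] := hM2.
have Tab_sqr (x : M) (u : tangent (f x)) : unit_tangent g u ->
    metric_norm g (slantT g f Jab x u) ^+ 2 =
    a (f x) ^+ 2 * cos (theta1 x) ^+ 2 + b (f x) ^+ 2 * cos (theta2 x) ^+ 2 +
    2 * a (f x) * b (f x) * g (f x) (T1 x u) (T2 x u).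
  by move=> ut; rewrite slantT_comb_sqr (cos_slant hJ1 s1 ut) (cos_slant hJ2 s2 ut).
have slant_cst theta : has_slant_angle g f Jab theta -> constant_product.
  move=> s x ab0 u u' Wu u1 Wu' u1'.
  have ut : unit_tangent g u by []. have ut' : unit_tangent g u' by [].
  have := Tab_sqr x u ut; rewrite -(cos_slant hJab s ut) (cos_slant hJab s ut').
  rewrite (Tab_sqr x u' ut') => /addrI/esym.
  by apply: mulfI; rewrite -mulrA mulf_neq0 // pnatr_eq0.
have cst_slant : constant_product -> has_slant_angle g f Jab (slant_function g f Jab).
  move=> cst; apply: slant_functionP => // x u u' ut ut'.
  apply/eqP; rewrite -(@eqrXn2 _ 2) ?metric_norm_ge0 // !Tab_sqr //.
  (* Where a b = 0 the cross term vanishes whatever u is. *)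
  have [ab0|ab0] := eqVneq (a (f x) * b (f x)) 0.
    by rewrite -!(mulrA 2) ab0 !mul0r.
  by rewrite (cst x ab0 u u') //; [case: ut|case: ut|case: ut'|case: ut'].
split=> //.
- by split=> [[theta /slant_cst]|/cst_slant]; [|exists (slant_function g f Jab)].
- split=> [[theta [itv s]]|[cst NW]].
    split=> [|x v Wv v0]; first exact: slant_cst s.
    have [c [u [c0 ut ->]]] := unit_tangentP g Wv v0.
    have /andP[th0 _] := itv x.
    have := slant_gt0_notin hJab s th0 ut; apply: contra.
    rewrite linearZ => /(memvZ c^-1).
    by rewrite scalerA mulVf // scale1r.
  exists (slant_function g f Jab); split; last exact: cst_slant.
  apply: slant_function_itv => // x u ut.
  by apply: NW; [case: ut | exact: unit_tangent_neq0 ut].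
- move=> theta s x u Wu u1; have ut : unit_tangent g u by [].
  rewrite ((has_slant_angleP f hJab theta).1 s x u ut).
  by rewrite -(Tab_sqr x u ut) sqrtr_sqr ger0_norm ?metric_norm_ge0.
Qed.
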